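(* Let $d$ be a fixed positive integer, let $\varepsilon>0$ be fixed, let $np=(1+\varepsilon)d\log n$, and let $Y=Y(n,p;d)$. Then there exists $\delta>0$ such that with high probability $\Phi_{Y}>\delta$.
   Context: $\log$ is the natural logarithm. $Y(n,p;d)$ is the random $d$-dimensional simplicial complex on $[n]$ containing all subsets of size at most $d$ as faces, in which each $(d+1)$-subset of $[n]$ is a $d$-face independently with probability $p$; $Y^{(j)}$ is the set of $j$-faces ($(j+1)$-element faces). With high probability means with probability tending to $1$ as $n\to\infty$. For $\sigma\in Y^{(d-1)}$, $\deg(\sigma)$ is the number of $d$-faces containing $\sigma$. For distinct $\sigma,\sigma'\in Y^{(d-1)}$ write $\sigma\sim\sigma'$ if some $\rho\in Y^{(d)}$ contains both. (With high probability all $\deg(\sigma)>0$.) Let $\pi(\sigma)=\frac{\deg(\sigma)}{(d+1)|Y^{(d)}|}$ and $\pi(S)=\sum_{\sigma\in S}\pi(\sigma)$ for $S\subseteq Y^{(d-1)}$; $\overline S=Y^{(d-1)}\setminus S$; $Q(S,\overline S)=\sum_{\sigma\in S}\sum_{\sigma'\in\overline S:\sigma'\sim\sigma}\pi(\sigma)\frac{1}{d\deg(\sigma)}$; $\Phi_Y(S)=\frac{Q(S,\overline S)}{\pi(S)\pi(\overline S)}$; and the conductance is $\Phi_Y=\min\{\Phi_Y(S):S\subset Y^{(d-1)},\ 0<\pi(S)\le 1/2\}$. *)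

(* Defs.v *)
From mathcomp Require Import all_boot all_order all_algebra.
From mathcomp Require Import all_classical all_reals all_analysis.

Set Implicit Arguments.
Unset Strict Implicit.
Unset Printing Implicit Defensive.

Import Order.TTheory GRing.Theory Num.Theory.
Local Open Scope ring_scope.

(* A complex on the vertex set [n] is given by its set of faces. *)
Definition faces (n : nat) (j : nat) (Y : {set {set 'I_n}}) : {set {set 'I_n}} :=
  [set s in Y | #|s| == j.+1].

Definition cells (n d : nat) : {set {set 'I_n}} :=
  [set s : {set 'I_n} | #|s| == d.+1].

Definition full_complex (n d : nat) (F : {set {set 'I_n}}) : {set {set 'I_n}} :=
  [set s : {set 'I_n} | (#|s| <= d)%N] :|: F.

(* Probability that Y(n, p; d) satisfies E: the set F of d-faces is a random
   subset of the (d+1)-subsets of [n], each one being retained independently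
   with probability p. *)
Definition prob_Y (R : realType) (n : nat) (p : R) (d : nat)
    (E : pred {set {set 'I_n}}) : R :=
  \sum_(F in powerset (cells n d) | E (full_complex d F))
    \prod_(rho in cells n d) (if rho \in F then p else 1 - p).

Definition deg (n d : nat) (Y : {set {set 'I_n}}) (s : {set 'I_n}) : nat :=
  #|[set rho in faces d Y | s \subset rho]|.

Definition adj (n d : nat) (Y : {set {set 'I_n}}) : rel {set 'I_n} :=
  fun s t => (s != t) &&
    [exists rho in faces d Y, (s \subset rho) && (t \subset rho)].

Definition stat (R : realType) (n d : nat) (Y : {set {set 'I_n}})
    (s : {set 'I_n}) : R :=
  (deg d Y s)%:R / (d.+1 * #|faces d Y|)%:R.

Definition stat_set (R : realType) (n d : nat) (Y S : {set {set 'I_n}}) : R :=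
  \sum_(s in S) stat R d Y s.

Definition compl_faces (n d : nat) (Y S : {set {set 'I_n}}) :
  {set {set 'I_n}} := faces d.-1 Y :\: S.

Definition flow (R : realType) (n d : nat) (Y S : {set {set 'I_n}}) : R :=
  \sum_(s in S) \sum_(t in compl_faces d Y S | adj d Y t s)
    stat R d Y s * (1 / (d * deg d Y s)%:R).

Definition Phi (R : realType) (n d : nat) (Y S : {set {set 'I_n}}) : R :=
  flow R d Y S / (stat_set R d Y S * stat_set R d Y (compl_faces d Y S)).

(* The infimum ranges over a finite set of reals, so it is a minimum as soon as
   Y has a d-face and d > 0; if Y has no d-face then no S is admissible and the
   conductance is 0 (inf of the empty set). *)
Definition conductance (R : realType) (n d : nat) (Y : {set {set 'I_n}}) : R :=
  inf [set Phi R d Y S | S in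
        [set S : {set {set 'I_n}} |
          (S \subset faces d.-1 Y) && (0 < stat_set R d Y S <= 1 / 2)]]%classic.

(* Main.v *)
(** Let [S] be a set of (d-1)-faces. Up to normalization, a d-face [rho]
    contributes one unit of flow for each pair of facets [s \in S] and
    [t \notin S] of [rho], and [s :&: t] is then a (d-2)-face [tau]; hence the
    flow out of [S] is the sum over all [tau] of the edge boundaries of the
    traces of [S] on the links of [tau]. Each link is a random graph
    G(n - d + 1, p), and [n p = (1 + eps) d ln n] is exactly what makes a union
    bound over the about n^(d-1) links and all vertex subsets work, so that with
    high probability every cut [(A, B)] of every link has at least
    [c p #|A| #|B|] edges. Summing over [tau] compares the flow with the
    boundary of [S] in the Johnson graph of d-subsets, which is at least of
    order [#|S| #|~S| / n^(d-1)] because any [s \in S] and [t \notin S] are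
    joined by a path of elementary exchanges inside [s :|: t]. All degrees are
    O(n p) with high probability, so the volumes in the denominator of [Phi] are
    O(n p #|S|) and O(n p #|~S|). *)

Require Import Defs.
From mathcomp Require Import all_boot all_order all_algebra zify ring lra.

Set Implicit Arguments.
Unset Strict Implicit.
Unset Printing Implicit Defensive.

Import Order.TTheory GRing.Theory Num.Theory.

(** * Isoperimetry in the Johnson graph of [d]-subsets *)

Lemma card_cover_le (T I : finType) (A : {set T}) (D : {set I})
    (B : I -> {set T}) :
  (forall x, x \in A -> exists2 i, i \in D & x \in B i) ->
  #|A| <= \sum_(i in D) #|B i|.
Proof.
move=> AB; rewrite -sum1_card.
under [leqRHS]eq_bigr do rewrite -sum1_card.
rewrite (exchange_big_dep predT) //= [leqLHS]big_mkcond leq_sum //= => x _.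
case: ifP => // /AB[i iD xB].
by rewrite sum1_card; apply/card_gt0P; exists i; rewrite unfold_in iD.
Qed.

Section Crossing.
Variables n d : nat.
Implicit Types (S F : {set {set 'I_n}}) (s t V : {set 'I_n}).

Definition ridges : {set {set 'I_n}} := [set s : {set 'I_n} | #|s| == d].

(** For a set [S] of ridges this is its edge boundary in the Johnson graph, each edge being oriented
    out of [S]. *)
Definition crossing S : {set {set 'I_n} * {set 'I_n}} :=
  [set st in setX S (ridges :\: S) | #|st.1 :|: st.2| == d.+1].

(** Induction on [#|t :\: s|]: trade some [u] in [s :\: t] for some [v] in [t :\: s]. Either the new
    set leaves [S] and this exchange crosses, or it is closer to [t]. Staying inside [s :|: t]
    limits how many pairs one crossing can serve. *)
Lemma exchange_path S s t : S \subset ridges -> s \in S -> t \in ridges :\: S ->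
  exists2 e, e \in crossing S & e.1 :|: e.2 \subset s :|: t.
Proof.
move=> /subsetP SR; have [k] := ubnP #|t :\: s|.
elim: k s => // k IH s kt sS tS.
have /[!inE]/eqP ds := SR _ sS.
have /[!inE]/andP[tnS /eqP dt] := tS.
have neq : s != t by apply: contraNneq tnS => <-.
have [v] : exists v, v \in t :\: s.
  apply/set0Pn; rewrite setD_eq0; apply: contra neq => ts.
  by rewrite eq_sym eqEcard ts dt ds /=.
rewrite inE => /andP[vs vt].
have [u] : exists u, u \in s :\: t.
  apply/set0Pn; rewrite setD_eq0; apply: contra neq => st.
  by rewrite eqEcard st dt ds /=.
rewrite inE => /andP[ut us].
set s1 := v |: (s :\ u).
have ds1 : #|s1| = d.
  by rewrite cardsU1 !inE (negPf vs) andbF -ds (cardsD1 u s) us.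
have s1U : s1 \subset s :|: t.
  apply/subsetP => x; rewrite !inE => /predU1P[->|/andP[_ ->//]].
  by rewrite vt orbT.
have [s1S|s1S] := boolP (s1 \in S).
  have [|e eX eU] := IH s1 _ s1S tS.
    move: kt; rewrite ltnS; apply: leq_trans; apply: proper_card.
    apply/properP; split.
      apply/subsetP => x; rewrite !inE !negb_or => /andP[/andP[xv]].
      case: eqP => //= [-> _ ut'|_ -> -> //]; first by rewrite ut' in ut.
    by exists v; rewrite !inE ?vs ?vt ?eqxx.
  exists e => //; apply: subset_trans eU _.
  by rewrite subUset s1U subsetUr.
exists (s, s1) => /=; last by rewrite subUset subsetUl.
rewrite !inE sS s1S ds1 eqxx /=.
suff -> : s :|: s1 = v |: s by rewrite cardsU1 vs ds.
apply/setP => x; rewrite !inE; case: eqP => [->|_] /=; first by rewrite orbT.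
by case: (x \in s); rewrite ?andbF.
Qed.

(** [s :|: t] is [V] plus at most [d.-1] vertices, listed in [n ^ d.-1] ways; then [s] and [t] lie
    in a set of at most [2 * d] elements, which leaves at most [4 ^ d] choices for each. *)
Lemma card_covering_pairs V : 0 < d -> #|V| = d.+1 ->
  #|[set st in setX ridges ridges | V \subset st.1 :|: st.2]|
    <= 16 ^ d * n ^ d.-1.
Proof.
move=> d0 dV.
have [v0 v0V] : exists v, v \in V by apply/card_gt0P; rewrite dV.
pose W (w : {ffun 'I_d.-1 -> 'I_n}) := V :|: [set w i | i in 'I_d.-1].
pose B w := setX (powerset (W w)) (powerset (W w)).
apply: leq_trans (card_cover_le (D := setT) (B := B) _) _; last first.
  apply: leq_trans (_ : \sum_(w in [set: {ffun 'I_d.-1 -> 'I_n}]) 16 ^ d <= _).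
    apply: leq_sum => w _; rewrite cardsX card_powerset -expnD.
    rewrite -[16]/(2 ^ 4) -expnM leq_exp2l //.
    suff : #|W w| <= d.*2 by lia.
    apply: leq_trans (leq_card_setU _ _) _; rewrite dV.
    apply: leq_trans (leq_add (leqnn _) (leq_imset_card _ _)) _.
    by rewrite card_ord; lia.
  by rewrite sum_nat_const cardsT card_ffun !card_ord mulnC.
move=> [s t]; rewrite inE in_setX ![_ \in ridges]inE /=.
move=> /andP[/andP[/eqP ds /eqP dt] VU].
set E := (s :|: t) :\: V.
have dE : #|E| <= d.-1.
  rewrite cardsD (setIidPr VU) dV cardsU ds dt.
  by lia.
(* The default [v0] pads a short [E]; it lies in [V], so [W w] gains nothing from it. *)
pose w : {ffun 'I_d.-1 -> 'I_n} := [ffun i : 'I_d.-1 => nth v0 (enum E) i].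
have UW : s :|: t \subset W w.
  apply/subsetP => x xU; rewrite inE.
  have [//|xV /=] := boolP (x \in V).
  have xE : x \in enum E by rewrite mem_enum inE xV.
  have ix : index x (enum E) < d.-1.
    by apply: leq_trans dE; rewrite cardE index_mem.
  by apply/imsetP; exists (Ordinal ix); rewrite // ffunE /= nth_index.
exists w; rewrite // !inE /=.
by rewrite !(subset_trans _ UW) // (subsetUl, subsetUr).
Qed.

(** Double counting: each pair [(s, t)] is charged to the crossing pair found on its exchange
    path. *)
Lemma crossing_lower_bound S : 0 < d -> S \subset ridges ->
  #|S| * #|ridges :\: S| <= #|crossing S| * (16 ^ d * n ^ d.-1).
Proof.
move=> d0 SR; rewrite -cardsX.
pose B (e : {set 'I_n} * {set 'I_n}) :=
  [set st in setX ridges ridges | e.1 :|: e.2 \subset st.1 :|: st.2].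
apply: leq_trans (card_cover_le (D := crossing S) (B := B) _) _.
  move=> [s t]; rewrite in_setX /= => /andP[sS tS].
  have [e eX eU] := exchange_path SR sS tS.
  have tR : t \in ridges by move: tS; rewrite in_setD => /andP[].
  by exists e => //; rewrite inE /= in_setX /= (subsetP SR) // tR eU.
apply: leq_trans (_ : \sum_(e in crossing S) 16 ^ d * n ^ d.-1 <= _);
  last first.
  by rewrite sum_nat_const.
apply: leq_sum => e; rewrite inE => /andP[_ /eqP dV].
exact: card_covering_pairs.
Qed.

End Crossing.

(** * Decomposition of the Johnson boundary along links *)

Section Links.
Variables n d : nat.
Implicit Types (S F : {set {set 'I_n}}) (s t tau A B : {set 'I_n}).

(** When [#|tau| = d.-1], these are the edges of the link graph of [tau] from [A] to the other link
    vertices. *)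
Definition link_cut F tau A : {set 'I_n * 'I_n} :=
  [set uv in setX A (~: tau :\: A) | uv.1 |: (uv.2 |: tau) \in F].

Definition link_part S tau : {set 'I_n} :=
  [set u in ~: tau | u |: tau \in S].

Lemma setU1_inj tau u v : u \notin tau -> u |: tau = v |: tau -> u = v.
Proof.
move=> uN /setP/(_ u); rewrite !inE eqxx (negPf uN) !orbF /=.
by move=> /esym/eqP.
Qed.

Lemma setU1_card1 tau s : tau \subset s -> #|s| = #|tau|.+1 ->
  exists2 u, u \notin tau & s = u |: tau.
Proof.
move=> ts cs; have : #|s :\: tau| == 1.
  by rewrite cardsD (setIidPr ts) cs subSnn.
move=> /cards1P[u su]; exists u.
  by have := set11 u; rewrite -su inE => /andP[].
by rewrite -su setUC -{1}(setIidPr ts) setID.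
Qed.

(** A crossing pair meeting in [tau] is [(u |: tau, v |: tau)] with [u] in the trace of [S] and [v]
    outside it; its union is [u |: (v |: tau)]. *)
Lemma card_crossing_link F S tau : 0 < d -> S \subset ridges n d ->
  #|tau| = d.-1 ->
  #|[set e in crossing d S | (e.1 :|: e.2 \in F) && (e.1 :&: e.2 == tau)]| =
  #|link_cut F tau (link_part S tau)|.
Proof.
move=> d0 SR dtau.
have dtau1 : #|tau|.+1 = d by rewrite dtau prednK.
pose f (uv : 'I_n * 'I_n) := (uv.1 |: tau, uv.2 |: tau).
rewrite -(card_in_imset (f := f)).
  apply: eq_card => -[s t].
  rewrite !inE /=; apply/idP/imsetP.
    move=> /andP[/andP[/andP[sS /andP[tnS dt]] dU] /andP[stF /eqP st]].
    have ds := subsetP SR _ sS; rewrite inE in ds.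
    have [||u un su] := @setU1_card1 tau s; first by rewrite -st subsetIl.
      by rewrite (eqP ds).
    have [||v vn tv] := @setU1_card1 tau t; first by rewrite -st subsetIr.
      by rewrite (eqP dt).
    exists (u, v); last by rewrite /f /= su tv.
    rewrite !inE /= un vn -su -tv sS tnS /=.
    by move: stF; rewrite su tv setUACA setUid -setUA.
  move=> [[u v]]; rewrite !inE /= => /andP[/andP[/andP[un uS]]].
  rewrite negb_and negbK => /andP[/orP[vt|vS] vn] uvF [-> ->].
    by rewrite vt in vn.
  have uv : u != v by apply: contraNneq vS => <-.
  have eU : (u |: tau) :|: (v |: tau) = u |: (v |: tau).
    by rewrite setUACA setUid -setUA.
  rewrite uS vS eU uvF !cardsU1 !inE negb_or uv un vn !add1n dtau1 !eqxx /=.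
  apply/eqP/setP => x; rewrite !inE.
  case: (eqVneq x u) => [->|_]; case: (eqVneq _ v) => [e|_] //=.
  - by rewrite e eqxx in uv.
  - by rewrite e (negPf vn).
  - by rewrite andbb.
move=> [u v] [u' v']; rewrite !inE /=.
move=> /andP[/andP[/andP[un _] /andP[_ vn]] _] _ [/(setU1_inj un) <-].
by move=> /(setU1_inj vn) <-.
Qed.

(** The two members of a crossing pair share [d + d - d.+1 = d.-1] elements, so the pairs can be
    sorted by intersection. *)
Lemma card_crossing F S : 0 < d -> S \subset ridges n d ->
  #|[set e in crossing d S | e.1 :|: e.2 \in F]| =
  \sum_(tau : {set 'I_n} | #|tau| == d.-1)
    #|link_cut F tau (link_part S tau)|.
Proof.
move=> d0 SR; rewrite -sum1_card.
rewrite (partition_big (fun e : {set 'I_n} * {set 'I_n} => e.1 :&: e.2)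
  (fun tau : {set 'I_n} => #|tau| == d.-1)) /=.
  apply: eq_bigr => tau /eqP dtau; rewrite -card_crossing_link // -sum1_card.
  by apply: eq_bigl => e; rewrite !inE -!andbA.
move=> [s t]; rewrite !inE /=.
move=> /andP[/andP[/andP[sS /andP[_ /eqP dt]] /eqP dU] _].
have := subsetP SR _ sS; rewrite inE => /eqP ds.
move: (cardsUI s t); rewrite ds dt dU => cst.
by apply/eqP; rewrite -[LHS](addKn d.+1) cst; lia.
Qed.

Lemma link_cutT tau A : A \subset ~: tau ->
  #|link_cut setT tau A| = #|A| * #|~: tau :\: A|.
Proof.
move=> At; rewrite -cardsX; apply: eq_card => e.
by rewrite inE in_setT andbT.
Qed.

End Links.

Local Open Scope ring_scope.

(** Applied later with [c * p] for [c]: every link cut keeps a fixed fraction of its expected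
    size. *)
Definition link_expanding (R : numDomainType) n d (c : R)
    (F : {set {set 'I_n}}) : bool :=
  [forall tau : {set 'I_n}, (#|tau| == d.-1) ==>
    [forall A : {set 'I_n}, (A \subset ~: tau) ==>
      (c * (#|A| * #|~: tau :\: A|)%:R <= #|link_cut F tau A|%:R)]].

(** For [F = setT] all links are complete and their cuts add up to the whole Johnson boundary, so
    the cut bounds can be summed over [tau]. *)
Lemma link_expanding_crossing (R : numDomainType) n d (c : R)
    (F S : {set {set 'I_n}}) :
  (0 < d)%N -> S \subset ridges n d -> link_expanding d c F ->
  c * #|crossing d S|%:R <=
  #|[set e in crossing d S | e.1 :|: e.2 \in F]|%:R.
Proof.
move=> d0 SR /forallP EF; rewrite card_crossing //.
have -> : #|crossing d S| = #|[set e in crossing d S | e.1 :|: e.2 \in setT]|.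
  by apply: eq_card => e; rewrite [RHS]inE in_setT andbT.
rewrite card_crossing // !natr_sum mulr_sumr; apply: ler_sum => tau dtau.
have := EF tau; rewrite dtau /= => /forallP/(_ (link_part S tau)).
have sub : link_part S tau \subset ~: tau.
  by apply/subsetP => x; rewrite inE => /andP[].
by rewrite sub link_cutT.
Qed.

From mathcomp Require Import all_classical all_reals all_analysis.
Import numFieldNormedType.Exports.

(** * Deterministic conductance bound from link expansion and bounded degrees *)

Section Complex.
Variables (n d : nat) (F : {set {set 'I_n}}).
Hypotheses (d0 : (0 < d)%N) (FC : F \subset cells n d).
Local Notation Y := (full_complex d F).
Implicit Types (S : {set {set 'I_n}}) (s t tau : {set 'I_n}).

Lemma faces_full_top : faces d Y = F.
Proof.
apply/finset.setP => s; rewrite !inE.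
apply/andP/idP => [[/orP[sd /eqP ds|//]]|sF].
  by rewrite ds ltnn in sd.
by have := fintype.subsetP FC _ sF; rewrite inE sF orbT => ->.
Qed.

Lemma faces_full_ridges : faces d.-1 Y = ridges n d.
Proof.
apply/finset.setP => s; rewrite !inE prednK //.
by case: eqP => [->|]; rewrite ?leqnn ?andbF.
Qed.

Lemma deg_full s : deg d Y s = #|[set rho in F | s \subset rho]|.
Proof. by rewrite /deg faces_full_top. Qed.

Lemma sum_deg : (\sum_(s in ridges n d) deg d Y s = d.+1 * #|F|)%N.
Proof.
under eq_bigr do rewrite deg_full -sum1_card.
rewrite (exchange_big_dep (fun rho => rho \in F)) /=; last first.
  by move=> s rho _; rewrite inE => /andP[].
rewrite mulnC -sum_nat_const; apply: eq_bigr => rho rhoF.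
have := fintype.subsetP FC _ rhoF; rewrite inE => /eqP drho.
rewrite sum1_card -[RHS](binSn d) -drho -cards_draws -sum1_card -[RHS]sum1_card.
by apply: eq_bigl => s; rewrite [LHS]unfold_in !inE rhoF /= andbC.
Qed.

Variable R : realType.

Lemma stat_setE S :
  stat_set R d Y S = (\sum_(s in S) deg d Y s)%:R / (d.+1 * #|F|)%:R.
Proof.
by rewrite /stat_set /stat faces_full_top -mulr_suml natr_sum.
Qed.

Lemma stat_set_compl S : (0 < #|F|)%N -> S \subset ridges n d ->
  stat_set R d Y S + stat_set R d Y (compl_faces d Y S) = 1.
Proof.
move=> F0 SR; rewrite !stat_setE /compl_faces faces_full_ridges -mulrDl -natrD.
have -> : (\sum_(s in S) deg d Y s + \sum_(s in ridges n d :\: S) deg d Y s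
    = d.+1 * #|F|)%N.
  rewrite -sum_deg [RHS](big_setID S) /=; congr addn.
  by rewrite (finset.setIidPr SR).
by rewrite divff // pnatr_eq0 muln_eq0 -lt0n F0.
Qed.

(** The degree cancels in each term of the flow, so every adjacent pair carries
    [1 / (d * d.+1 * #|F|)]; a crossing pair whose union is in [F] is adjacent. *)
Lemma flow_lower_bound S : S \subset ridges n d ->
  #|[set e in crossing d S | e.1 :|: e.2 \in F]|%:R
    / (d * (d.+1 * #|F|))%:R <= flow R d Y S.
Proof.
move=> SR; rewrite /flow /compl_faces faces_full_ridges.
rewrite pair_big_dep /= mulrC mulr_natr -sumr_const.
rewrite big_mkcond [leRHS]big_mkcond /=; apply: ler_sum => -[s t] _ /=.
rewrite !inE /=.
case: ifP => [/andP[/andP[/andP[sS tR] /eqP dU] UF]|_]; last first.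
  by case: ifP => // _; rewrite mulr_ge0 ?divr_ge0.
have ds := fintype.subsetP SR _ sS; rewrite inE in ds.
have st : s \subset s :|: t by apply: finset.subsetUl.
have dt : #|t| == d by case/andP: tR.
have ats : adj d Y t s.
  rewrite /adj; apply/andP; split.
    by apply: contraTneq tR => ->; rewrite sS.
  apply/existsP; exists (s :|: t).
  by rewrite faces_full_top UF st finset.subsetUr.
rewrite sS tR ats /=.
have g0 : (0 < deg d Y s)%N.
  by rewrite deg_full; apply/card_gt0P; exists (s :|: t); rewrite inE UF.
rewrite /stat faces_full_top !natrM.
have F0 : (0 < #|F|)%N by apply/card_gt0P; exists (s :|: t).
have : (#|F|%:R : R) != 0 by rewrite pnatr_eq0 -lt0n.
have : ((deg d Y s)%:R : R) != 0 by rewrite pnatr_eq0 -lt0n.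
have : (d%:R : R) != 0 by rewrite pnatr_eq0 -lt0n.
have : (d.+1%:R : R) != 0 by rewrite pnatr_eq0.
move: (d.+1%:R : R) (d%:R : R) (_%:R : R) (#|F|%:R : R) => a b c f a0 b0 c0 f0.
rewrite le_eqVlt; apply/orP; left; apply/eqP.
by field; rewrite a0 b0 c0 f0.
Qed.

(* The product [#|S| * #|ridges n d :\: S|] bounds both the number of crossing
   pairs from below and the product of the two volumes from above, so that it
   cancels in [Phi]. *)
Lemma Phi_lower_bound (c D : R) S : (0 < n)%N -> 0 <= c ->
  link_expanding d c F ->
  (forall s, s \in ridges n d -> (deg d Y s)%:R <= D) ->
  S \subset ridges n d -> 0 < stat_set R d Y S ->
  0 < stat_set R d Y (compl_faces d Y S) ->
  c * (d.+1 * #|F|)%:R / ((16 ^ d * n ^ d.-1)%:R * d%:R * D ^+ 2)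
    <= Phi R d Y S.
Proof.
move=> n0 c0 EF DF SR pS pC.
set K : R := (16 ^ d * n ^ d.-1)%:R; set M : R := (d.+1 * #|F|)%:R.
have K0 : 0 < K by rewrite ltr0n muln_gt0 !expn_gt0 n0.
have M0 : 0 < M.
  rewrite lt0r ler0n andbT; apply: contraTneq pS => M0.
  by rewrite stat_setE -/M M0 invr0 mulr0 ltxx.
have dR0 : 0 < d%:R :> R by rewrite ltr0n.
have vol (T : {set {set 'I_n}}) :
    T \subset ridges n d -> stat_set R d Y T <= #|T|%:R * D / M.
  move=> TR; rewrite stat_setE ler_pM2r ?invr_gt0 // natr_sum mulr_natl.
  by rewrite -sumr_const; apply: ler_sum => s /(fintype.subsetP TR)/DF.
have CR : compl_faces d Y S \subset ridges n d.
  by rewrite /compl_faces faces_full_ridges finset.subsetDl.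
have D0 : 0 < D.
  have := lt_le_trans pS (vol _ SR).
  rewrite pmulr_lgt0 ?invr_gt0 //; case: #|S| => [|k];
    last by rewrite pmulr_rgt0.
  by rewrite mul0r ltxx.
rewrite /Phi ler_pdivlMr ?mulr_gt0 //.
apply: le_trans (flow_lower_bound SR).
have prod_vol : stat_set R d Y S * stat_set R d Y (compl_faces d Y S) <=
    (#|S| * #|ridges n d :\: S|)%:R * (D / M) ^+ 2.
  have -> : (#|S| * #|ridges n d :\: S|)%:R * (D / M) ^+ 2 =
    (#|S|%:R * D / M) * (#|compl_faces d Y S|%:R * D / M).
    by rewrite natrM /compl_faces faces_full_ridges; ring.
  by apply: ler_pM; rewrite ?(ltW pS) ?(ltW pC) ?vol.
have cross := crossing_lower_bound d0 SR.
rewrite -(ler_nat R) [leRHS]natrM -/K in cross.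
have cross' := link_expanding_crossing d0 SR EF.
have step : c * M / (K * d%:R * D ^+ 2) *
    ((#|S| * #|ridges n d :\: S|)%:R * (D / M) ^+ 2) <=
    #|[set e in crossing d S | e.1 :|: e.2 \in F]|%:R
      / (d * (d.+1 * #|F|))%:R.
  rewrite (natrM _ d) -/M.
  have -> : c * M / (K * d%:R * D ^+ 2) *
      ((#|S| * #|ridges n d :\: S|)%:R * (D / M) ^+ 2)
    = (c * ((#|S| * #|ridges n d :\: S|)%:R / K)) / (d%:R * M).
    by clearbody K M; field; rewrite !gt_eqF.
  rewrite ler_pM2r ?invr_gt0 ?mulr_gt0 //.
  by apply: le_trans cross'; rewrite ler_wpM2l // ler_pdivrMr.
apply: le_trans step; apply: ler_wpM2l prod_vol.
by rewrite divr_ge0 ?mulr_ge0 ?exprn_ge0 //;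
  rewrite ltW.
Qed.

(** Delete a vertex [v] from [s]: in the link of [s :\ v], the edges at [v] yield distinct [d]-faces
    containing [s], so the cut condition for [[set v]] gives the bound. *)
Lemma deg_lower_bound (c : R) s : link_expanding d c F -> s \in ridges n d ->
  c * (n - d)%:R <= (deg d Y s)%:R.
Proof.
move=> /forallP EF; rewrite inE => /eqP ds.
have [v vs] : exists v, v \in s by apply/card_gt0P; rewrite ds.
have dsv : #|s :\ v| = d.-1 by rewrite -ds (cardsD1 v s) vs.
have := EF (s :\ v); rewrite dsv eqxx /= => /forallP/(_ [set v]).
have vsub : [set v] \subset ~: (s :\ v) by rewrite finset.sub1set !inE eqxx.
rewrite vsub cards1 mul1n /=.
have -> : ~: (s :\ v) :\: [set v] = ~: s.
  apply/finset.setP => x; rewrite !inE negb_and negbK.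
  by case: eqP => [->|//]; rewrite vs.
have -> : #|~: s| = (n - d)%N by rewrite cardsCs finset.setCK card_ord ds.
move=> /le_trans; apply; rewrite ler_nat deg_full.
pose f (uv : 'I_n * 'I_n) := uv.1 |: (uv.2 |: (s :\ v)).
rewrite -(card_in_imset (f := f)).
  apply: subset_leq_card; apply/fintype.subsetP => r /imsetP[[x y]].
  rewrite !inE /= => /andP[/andP[/eqP-> _] rF] ->.
  rewrite /f /= rF /=; apply/fintype.subsetP => z zs; rewrite !inE zs andbT.
  by case: (z == v); rewrite ?orbT.
move=> [x y] [x' y']; rewrite !inE /f /=.
move=> /andP[/andP[/eqP-> /andP[yv yN]] _] /andP[/andP[/eqP-> _] _].
move=> /finset.setP/(_ y); rewrite !inE eqxx (negPf yv) /=.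
rewrite yv /= in yN; rewrite (negPf yN) orbF.
by move/esym/eqP => ->.
Qed.

(** Link expansion also bounds the degrees from below; summing them bounds the total volume
    [d.+1 * #|F|] in the numerator of [Phi_lower_bound]. *)
Lemma conductance_lower_bound (c D b : R) : (d < n)%N -> 0 < c ->
  link_expanding d c F ->
  (forall s, s \in ridges n d -> (deg d Y s)%:R <= D) ->
  b <= c * (c * 'C(n, d)%:R * (n - d)%:R) /
         ((16 ^ d * n ^ d.-1)%:R * d%:R * D ^+ 2) ->
  b <= conductance R d Y.
Proof.
move=> dn c0 EF DF bd.
have nd0 : (0 < n - d)%N by rewrite subn_gt0.
have deg0 s : s \in ridges n d -> (0 < deg d Y s)%N.
  move=> /(deg_lower_bound EF); rewrite -(ltr_nat R); apply: lt_le_trans.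
  by rewrite mulr_gt0 ?ltr0n.
have cR : #|ridges n d| = 'C(n, d) by rewrite card_draws card_ord.
have [s0 s0R] : exists s, s \in ridges n d.
  by apply/card_gt0P; rewrite cR bin_gt0 ltnW.
have F0 : (0 < #|F|)%N.
  have := deg0 _ s0R; rewrite deg_full => /card_gt0P[rho].
  by rewrite inE => /andP[rF _]; apply/card_gt0P; exists rho.
have volF : c * 'C(n, d)%:R * (n - d)%:R <= (d.+1 * #|F|)%:R.
  rewrite -sum_deg natr_sum -cR mulrAC mulr_natr -sumr_const.
  by apply: ler_sum => s; apply: deg_lower_bound.
(* The infimum is over a nonempty set: [[set s0]] is admissible, since its degree is at most [#|F|]
   and [2 <= d.+1]. *)
apply: lb_le_inf.
  exists (Phi R d Y [set s0]), [set s0] => //=.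
  rewrite finset.sub1set faces_full_ridges s0R stat_setE big_set1 /=.
  rewrite divr_gt0 ?ltr0n ?muln_gt0 ?F0 ?deg0 //=.
  rewrite ler_pdivrMr ?ltr0n ?muln_gt0 ?F0 // mul1r ler_pdivlMl ?ltr0n //.
  rewrite -natrM ler_nat leq_mul // deg_full subset_leq_card //.
  by apply/fintype.subsetP => rho; rewrite inE => /andP[].
move=> _ [S /= /andP[SR /andP[pS pS2]] <-].
rewrite faces_full_ridges in SR.
apply: (le_trans bd); apply: le_trans (_ : _ <= Phi R d Y S); last first.
  apply: (Phi_lower_bound _ (ltW c0) EF DF SR pS).
    exact: leq_ltn_trans dn.
  by have := stat_set_compl F0 SR; lra.
have D0 : 0 <= D := le_trans (ler0n _ _) (DF _ s0R).
rewrite ler_wpM2r ?invr_ge0 ?mulr_ge0 //.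
by rewrite ler_wpM2l // ltW.
Qed.

End Complex.

(** * Product measure: exponential moments, union bound and tails *)

Section RandomFaces.
Variables (R : realType) (n d : nat) (p : R).
Hypothesis p01 : 0 <= p <= 1.
Implicit Types (F G : {set {set 'I_n}}) (b : pred {set {set 'I_n}}).

Definition weight F : R :=
  \prod_(rho in cells n d) (if rho \in F then p else 1 - p).

Definition prob_faces b : R :=
  \sum_(F in powerset (cells n d) | b F) weight F.

Lemma weight_ge0 F : 0 <= weight F.
Proof.
by apply: prodr_ge0 => rho _; case/andP: p01 => ? ?; case: ifP => _; lra.
Qed.

(** Generating function of the binomial variable [#|F :&: G|]; an empty [G] gives total mass 1, and
    [x = expR t] gives the tails. *)
Lemma sum_weight_expn G (x : R) : G \subset cells n d ->
  \sum_(F in powerset (cells n d)) weight F * x ^+ #|F :&: G| =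
  (1 - p + p * x) ^+ #|G|.
Proof.
move=> GC.
(* When the product of the [f rho + g rho] is expanded, [f] vanishes off [cells n d], so only
   subsets of [cells n d] survive. *)
pose f rho := if rho \in cells n d then p * (if rho \in G then x else 1) else 0.
pose g rho := if rho \in cells n d then 1 - p else 1.
transitivity (\prod_rho (f rho + g rho)); last first.
  rewrite -prodr_const big_mkcond [RHS]big_mkcond /=; apply: eq_bigr => rho _.
  rewrite /f /g; case: ifP => rC; case: ifP => rG; try by ring.
  by have := fintype.subsetP GC _ rG; rewrite rC.
rewrite bigA_distr [RHS](bigID (mem (powerset (cells n d)))) /=.
rewrite [X in _ = _ + X]big1 ?addr0; last first.
  move=> F; rewrite powersetE => /subsetPn[rho rF rC].
  by rewrite (bigD1 rho) //= rF /f (negPf rC) mul0r.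
apply: eq_bigr => F; rewrite powersetE => FC.
rewrite -prodr_const big_mkcond /= /weight [X in X * _]big_mkcond -big_split /=.
apply: eq_bigr => rho _; rewrite finset.in_setI /f /g.
have [rF|rF] := boolP (rho \in F); last by rewrite mulr1.
rewrite (fintype.subsetP FC) //=; case: ifP => _; ring.
Qed.

Lemma prob_facesC b : prob_faces (fun F => ~~ b F) = 1 - prob_faces b.
Proof.
have <- : \sum_(F in powerset (cells n d)) weight F = 1.
  transitivity (\sum_(F in powerset (cells n d))
    weight F * 1 ^+ #|F :&: finset.set0|).
    by apply: eq_bigr => F _; rewrite expr1n mulr1.
  by rewrite sum_weight_expn ?cards0 // finset.sub0set.
by rewrite (bigID b) /= [X in X - _]addrC addrK.
Qed.

Lemma union_bound (I : finType) (D : {pred I}) b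
    (c : I -> pred {set {set 'I_n}}) :
  (forall F, F \subset cells n d -> b F -> exists2 i, i \in D & c i F) ->
  prob_faces b <= \sum_(i in D) prob_faces (c i).
Proof.
move=> bc; rewrite /prob_faces.
under [leRHS]eq_bigr do rewrite big_mkcondr.
rewrite exchange_big /= big_mkcondr; apply: ler_sum => F.
rewrite powersetE => FC; case: ifP => [/(bc _ FC)[i iD ci]|_].
  rewrite (bigD1 i) //= ci lerDl; apply: sumr_ge0 => j _.
  by case: ifP => // _; apply: weight_ge0.
by apply: sumr_ge0 => j _; case: ifP => // _; apply: weight_ge0.
Qed.

(* Exponential Markov inequality; [t < 0] gives the lower tail and [0 < t] the
   upper tail. *)
Lemma prob_faces_tail G b (t k : R) : G \subset cells n d ->
  (forall F, F \subset cells n d -> b F -> t * k <= t * #|F :&: G|%:R) ->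
  prob_faces b <= expR (p * (expR t - 1) * #|G|%:R - t * k).
Proof.
move=> GC bk; rewrite expRD.
have -> : expR (p * (expR t - 1) * #|G|%:R) = expR (p * (expR t - 1)) ^+ #|G|.
  by rewrite -expRM_natr.
apply: le_trans (_ : (1 - p + p * expR t) ^+ #|G| * expR (- (t * k)) <= _).
  rewrite -sum_weight_expn // mulr_suml /prob_faces big_mkcondr /=.
  apply: ler_sum => F; rewrite powersetE => FC; case: ifP => [/(bk _ FC) tk|_].
    rewrite -mulrA ler_peMr ?weight_ge0 // -expRM_natr -expRD.
    rewrite -[leLHS]expR0 ler_expR.
    by lra.
  by rewrite !mulr_ge0 ?weight_ge0 ?exprn_ge0 ?expR_ge0.
rewrite ler_pM2r ?expR_gt0 // lerXn2r ?nnegrE ?expR_ge0 //.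
  by case/andP: p01 => ? ?; have := expR_gt0 t; nra.
apply: le_trans (expR_ge1Dx _); lra.
Qed.

End RandomFaces.

(** * Probability of a large degree or of a sparse link cut *)

Section Events.
Variables (R : realType) (n d : nat) (p : R).
Hypotheses (p01 : 0 <= p <= 1) (d0 : (0 < d)%N).
Implicit Types (F G : {set {set 'I_n}}) (s tau A : {set 'I_n}).

Lemma card_cofaces s : s \in ridges n d ->
  (#|[set rho in cells n d | s \subset rho]| <= n)%N.
Proof.
rewrite inE => /eqP ds.
apply: leq_trans (_ : #|[set v |: s | v in [set: 'I_n]]| <= _)%N; last first.
  by rewrite (leq_trans (leq_imset_card _ _)) // cardsT card_ord.
apply: subset_leq_card; apply/fintype.subsetP => rho.
rewrite !inE => /andP[/eqP drho sr].
have [|v _ ->] := setU1_card1 sr; first by rewrite drho ds.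
by apply/imsetP; exists v.
Qed.

(** Upper tail at [t = 1]. The threshold factor [expR 1 + 1] exceeds [expR 1 - 1] by 2, which is the
    2 in the exponent. *)
Lemma prob_high_degree s : s \in ridges n d ->
  prob_faces d p (fun F =>
    (expR 1 + 1) * (n%:R * p) < #|[set rho in F | s \subset rho]|%:R)
  <= expR (- (2 * (n%:R * p))).
Proof.
move=> sR; set k := (_ + _) * _.
set G := [set rho in cells n d | s \subset rho].
have GC : G \subset cells n d.
  by apply/fintype.subsetP => rho; rewrite inE => /andP[].
apply: (le_trans (prob_faces_tail (t := 1) (k := k) p01 GC _)).
  move=> F FC /ltW; rewrite !mul1r => /le_trans; apply; rewrite ler_nat.
  apply: subset_leq_card; apply/fintype.subsetP => rho.
  rewrite [in X in X -> _]inE => /andP[rF sr].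
  by rewrite finset.in_setI rF finset.inE (fintype.subsetP FC).
rewrite ler_expR mul1r /k.
have : p * #|G|%:R <= n%:R * p.
  rewrite mulrC ler_wpM2r ?ler_nat ?card_cofaces //.
  by case/andP: p01.
have := expR_ge1Dx (1 : R).
nra.
Qed.

(** The potential [d]-faces that decide a link cut; the size of the cut becomes
    [#|F :&: link_cells tau A|], to which the tail bound applies. *)
Definition link_cells tau A : {set {set 'I_n}} :=
  [set uv.1 |: (uv.2 |: tau) | uv in finset.setX A (~: tau :\: A)].

(** [A], [~: tau :\: A] and [tau] are pairwise disjoint, so [u] and [v] can be read off the
    union. *)
Lemma link_cells_inj tau A : A \subset ~: tau ->
  {in finset.setX A (~: tau :\: A) &,
    injective (fun uv : 'I_n * 'I_n => uv.1 |: (uv.2 |: tau))}.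
Proof.
move=> At [u v] [u' v']; rewrite !finset.inE /=.
move=> /andP[uA /andP[vA vt]] /andP[uA' /andP[vA' vt']] e.
have ut := fintype.subsetP At _ uA; have ut' := fintype.subsetP At _ uA'.
rewrite !finset.inE in ut ut'.
have /finset.setP/(_ u) := e; rewrite !finset.inE eqxx (negPf ut) !orbF /=.
have -> : (u == v') = false by apply: contraNF vA' => /eqP <-.
rewrite orbF => /esym/eqP uu; congr pair => //.
have /finset.setP/(_ v) := e; rewrite !finset.inE eqxx (negPf vt) orbT !orbF /=.
have -> : (v == u') = false by apply: contraNF vA => /eqP ->.
by move=> /esym/eqP.
Qed.

Lemma link_cells_sub tau A : #|tau| = d.-1 -> A \subset ~: tau ->
  link_cells tau A \subset cells n d.
Proof.
move=> dt At; apply/fintype.subsetP => rho /imsetP[[u v] uvX ->].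
move: uvX; rewrite !finset.inE /= => /andP[uA /andP[vA vt]].
have ut := fintype.subsetP At _ uA; rewrite inE in ut.
rewrite !cardsU1 !finset.inE negb_or ut vt dt andbT.
have -> : u != v by apply: contraNneq vA => <-.
by rewrite !add1n prednK.
Qed.

Lemma card_link_cells tau A : A \subset ~: tau ->
  #|link_cells tau A| = (#|A| * #|~: tau :\: A|)%N.
Proof. by move=> At; rewrite (card_in_imset (link_cells_inj At)) cardsX. Qed.

Lemma card_setI_link_cells F tau A : A \subset ~: tau ->
  #|F :&: link_cells tau A| = #|link_cut F tau A|.
Proof.
move=> At; rewrite -(card_in_imset (f := fun uv => uv.1 |: (uv.2 |: tau))).
  apply: eq_card => rho; rewrite finset.in_setI; apply/andP/imsetP.
    move=> [rF /imsetP[uv uvX e]]; exists uv => //.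
    by rewrite inE uvX -e.
  move=> [uv]; rewrite inE => /andP[uvX uvF] ->; split=> //.
  by apply/imsetP; exists uv.
move=> x y /[1!inE] /andP[xX _] /[1!inE] /andP[yX _].
exact: (link_cells_inj At xX yX).
Qed.

(** Lower tail at [- t]. The rate [1 - expR (- t) - c * t] comes close to 1 for large [t] and then
    small [c], so little of the margin [eps] is lost. *)
Lemma prob_sparse_link tau A (t c : R) : 0 <= t ->
  #|tau| = d.-1 -> A \subset ~: tau ->
  prob_faces d p (fun F => #|link_cut F tau A|%:R <
    c * p * (#|A| * #|~: tau :\: A|)%:R)
  <= expR (- ((1 - expR (- t) - c * t) * (p * (#|A| * #|~: tau :\: A|)%:R))).
Proof.
move=> t0 dt At; set m := (_ * _)%N.
apply: (le_trans (prob_faces_tail (t := - t) (k := c * p * m%:R) p01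
  (link_cells_sub dt At) _)).
  move=> F _ /ltW; rewrite card_setI_link_cells // => le.
  by rewrite !mulNr lerN2 ler_wpM2l.
by rewrite ler_expR card_link_cells // -/m; lra.
Qed.

(** This symmetry lets the union bound run over the smaller side of each cut only. *)
Lemma card_link_cutC F tau A : A \subset ~: tau ->
  #|link_cut F tau (~: tau :\: A)| = #|link_cut F tau A|.
Proof.
move=> At; have AC : ~: tau :\: (~: tau :\: A) = A.
  by rewrite finset.setDDr finset.setDv finset.set0U (finset.setIidPr At).
have swapK : involutive (fun q : 'I_n * 'I_n => (q.2, q.1)) by case.
rewrite -(card_imset _ (inv_inj swapK)); apply: eq_card => -[u v].
have mem x y (B : {set 'I_n}) : ((x, y) \in link_cut F tau B) =
   [&& x \in B, y \in ~: tau :\: B & x |: (y |: tau) \in F].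
  by rewrite /link_cut finset.in_set finset.in_setX andbA.
rewrite mem; apply/imsetP/and3P.
  move=> [[x y]]; rewrite mem AC => /and3P[xA yA xyF] [-> ->].
  by rewrite finset.setUCA.
by move=> [uA vA uvF]; exists (v, u) => //; rewrite mem AC uA vA finset.setUCA.
Qed.

Lemma prob_bad_complex (t c : R) : 0 <= t ->
  prob_faces d p (fun F => ~~ (link_expanding d (c * p) F &&
    [forall s in ridges n d,
      (deg d (full_complex d F) s)%:R <= (expR 1 + 1) * (n%:R * p)]))
  <= #|ridges n d|%:R * expR (- (2 * (n%:R * p))) +
     \sum_(tau : {set 'I_n} | #|tau| == d.-1)
     \sum_(A : {set 'I_n} |
       (A \subset ~: tau) && (0 < #|A| <= #|~: tau :\: A|)%N)
     expR (- ((1 - expR (- t) - c * t) * (p * (#|A| * #|~: tau :\: A|)%:R))).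
Proof.
move=> t0.
pose bad_deg F := [exists s in ridges n d,
  (expR 1 + 1) * (n%:R * p) < (#|[set rho in F | s \subset rho]|%:R : R)].
pose bad_link F := ~~ link_expanding d (c * p) F.
apply: le_trans (_ : prob_faces d p bad_deg + prob_faces d p bad_link <= _).
  apply: le_trans (union_bound p01 (D := predT)
    (c := fun i : bool => if i then bad_deg else bad_link) _) _.
    move=> F FC; rewrite negb_and => /orP[?|]; first by exists false.
    move=> /forall_inPn[s sR]; rewrite -ltNge => le; exists true => //.
    by apply/exists_inP; exists s => //; rewrite -(deg_full FC).
  by rewrite big_bool.
apply: lerD.
  rewrite mulr_natl -sumr_const.
  apply: le_trans (union_bound p01 (D := ridges n d) (c := fun s F =>
    (expR 1 + 1) * (n%:R * p) <
      (#|[set rho in F | s \subset rho]|%:R : R)) _) _.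
    by move=> F FC /exists_inP[s sR bs]; exists s.
  by apply: ler_sum => s; apply: prob_high_degree.
rewrite pair_big_dep /=.
apply: le_trans (union_bound p01 (D := fun q : {set 'I_n} * {set 'I_n} =>
    (#|q.1| == d.-1) &&
    ((q.2 \subset ~: q.1) && (0 < #|q.2| <= #|~: q.1 :\: q.2|)%N))
   (c := fun q F => #|link_cut F q.1 q.2|%:R <
    c * p * (#|q.2| * #|~: q.1 :\: q.2|)%:R) _) _.
  move=> F FC /forallPn[tau]; rewrite negb_imply => /andP[dt].
  move=> /forallPn[A]; rewrite negb_imply -ltNge => /andP[At bad].
  wlog AB : A At bad / (#|A| <= #|~: tau :\: A|)%N.
    move=> wl; have [|/ltnW AB] := leqP #|A| #|~: tau :\: A|; first exact: wl.
    have AC : ~: tau :\: (~: tau :\: A) = A.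
      by rewrite finset.setDDr finset.setDv finset.set0U (finset.setIidPr At).
    apply: (wl (~: tau :\: A)); rewrite ?finset.subsetDl ?AC //.
    by rewrite card_link_cutC // mulnC.
  exists (tau, A) => //=; rewrite unfold_in /= dt At AB andbT /=.
  (* An empty side cannot be bad, the required cut size being 0. *)
  by rewrite lt0n; apply: contraTneq bad => ->; rewrite mul0n mulr0 ltNge ler0n.
apply: ler_sum => -[tau A] /andP[/eqP dt /andP[At _]] /=.
by apply: prob_sparse_link.
Qed.

End Events.

(** * Summation of the failure probabilities *)

Lemma bin_le_expn n m : ('C(n, m) <= n ^ m)%N.
Proof.
apply: leq_trans (_ : n ^_ m <= _)%N.
  by rewrite -bin_ffact leq_pmulr // fact_gt0.
rewrite ffact_prod -[X in (_ <= _ ^ X)%N]card_ord -prod_nat_const.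
by apply: leq_prod => i _; apply: leq_subr.
Qed.

Lemma sum_card_expn (R : comNzRingType) n (y : R) :
  \sum_(A : {set 'I_n}) y ^+ #|A| = (1 + y) ^+ n.
Proof.
rewrite -[in RHS](card_ord n) -prodr_const addrC bigA_distr.
by apply: eq_bigr => A _; rewrite -big_mkcond prodr_const.
Qed.

Section Estimates.
Variable R : realType.

(* A cut of a link whose smaller side has [a = o(n)] vertices is crossed by
   almost [a * n] potential cells, which beats the choice of that side and of
   the link; when both sides are linear in [n], the exponent dwarfs the [2 ^ n]
   choices of a side. *)
Lemma link_exponent (eps theta L d n a b X : R) :
  0 < eps -> 1 <= d -> 1 <= a -> a <= b ->
  a + b + d = n + 1 -> 0 < L ->
  theta * (1 + eps / 2) = eps / 4 -> 2 * d <= theta * n ->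
  8 * (d + 2) <= theta * L ->
  (1 + eps / 2) * d * L * (a * b) <= n * X ->
  ((d - 1) * L + (1 + eps / 4 * d) * L * a <= X) \/ ((d + 2) * n <= X).
Proof.
move=> eps0 d1 a1 ab abn L0 th n0 Lb nX.
have th0 : 0 < theta by nra.
have th1 : theta < 1 by nra.
have npos : 0 < n by nra.
have [bn|bn] := leP ((1 - theta) * n) b; [left|right].
  have X1 : (1 + eps / 4) * d * L * a <= X.
    rewrite -(ler_pM2l npos); apply: le_trans nX.
    have -> : n * ((1 + eps / 4) * d * L * a) =
       (1 + eps / 2) * d * L * (a * ((1 - theta) * n)) +
       (theta * (1 + eps / 2) - eps / 4) * (d * L * a * n) by field.
    rewrite th subrr mul0r addr0; apply: ler_wpM2l.
      by rewrite !mulr_ge0 //; lra.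
    by apply: ler_wpM2l => //; lra.
  apply: le_trans X1.
  have : 0 <= (d - 1) * (a - 1) * L by rewrite !mulr_ge0 //; lra.
  lra.
have ha : theta * n / 2 <= a by lra.
have hb : n / 4 <= b.
  have : theta * n <= n by rewrite ger_pMl // ltW.
  lra.
rewrite -(ler_pM2l npos); apply: le_trans nX.
have h1 : (theta * n / 2) * (n / 4) <= a * b.
  by apply: ler_pM => //; rewrite ?divr_ge0 ?mulr_ge0 ?ltW //; lra.
have h2 : L <= (1 + eps / 2) * d * L by rewrite ler_peMl ?ltW //; nra.
apply: le_trans (_ : L * ((theta * n / 2) * (n / 4)) <= _).
  have : 0 <= (theta * L - 8 * (d + 2)) * (n * n) by rewrite !mulr_ge0 //; lra.
  lra.
by apply: ler_pM h2 h1; rewrite ltW // !(mulr_gt0, divr_gt0).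
Qed.

Variables (d : nat) (eps : R).
Hypotheses (d0 : (0 < d)%N) (eps0 : 0 < eps).

(** The two alternatives of [link_exponent] bound each summand by [E1 * y ^+ #|A|] or by [E2]; the
    two families are summed separately and multiplied by the number of links. *)
Lemma link_union_bound n (q p theta : R) :
  let L := ln (n%:R : R) in
  theta * (1 + eps / 2) = eps / 4 -> 0 < L ->
  n%:R * p = (1 + eps) * d%:R * L -> 1 + eps / 2 <= q * (1 + eps) ->
  2 * d%:R <= theta * n%:R -> 8 * (d%:R + 2) <= theta * L ->
  \sum_(tau : {set 'I_n} | #|tau| == d.-1)
  \sum_(A : {set 'I_n} | (A \subset ~: tau) && (0 < #|A| <= #|~: tau :\: A|)%N)
     expR (- (q * (p * (#|A| * #|~: tau :\: A|)%:R)))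
  <= (expR (expR (- (eps / 4 * d%:R * L))) - 1) + expR (- L).
Proof.
have e0 := eps0; move=> L th L0 np qe nb Lb.
have dR1 : 1 <= d%:R :> R by rewrite ler1n.
have th0 : 0 < theta by nra.
have n0 : 0 < n%:R :> R.
  by rewrite -(pmulr_rgt0 _ th0); apply: lt_le_trans nb; lra.
have Ln : L <= n%:R.
  exact: ltW (ln_sublinear n0).
have nE : n%:R = expR L by rewrite lnK // posrE.
clearbody L.
(* As [L = ln n], [y] is the price per vertex of the smaller side and beats the [n] choices of that
   vertex; [E1] pays for the at most [n ^ d.-1] links, and [E2] beats the [2 ^ n] sides. *)
pose y : R := expR (- ((1 + eps / 4 * d%:R) * L)).
pose E1 : R := expR (- ((d%:R - 1) * L)).
pose E2 : R := expR (- ((d%:R + 2) * n%:R)).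
have y0 : 0 <= y by apply: expR_ge0.
have inner (tau : {set 'I_n}) : #|tau| = d.-1 ->
  \sum_(A : {set 'I_n} | (A \subset ~: tau) && (0 < #|A| <= #|~: tau :\: A|)%N)
     expR (- (q * (p * (#|A| * #|~: tau :\: A|)%:R))) <=
  E1 * ((1 + y) ^+ n - 1) + 2 ^+ n * E2.
  (* Leaving out the empty side gives the [- 1], without which the bound would not tend to 0. *)
  move=> dt; have -> : (1 + y) ^+ n - 1 =
      \sum_(A : {set 'I_n} | A != finset.set0) y ^+ #|A|.
    rewrite -sum_card_expn (bigD1 finset.set0) //=.
    by rewrite cards0 expr0 addrAC subrr add0r.
  rewrite mulr_sumr.
  have -> : 2 ^+ n * E2 = \sum_(A : {set 'I_n}) E2.
    rewrite sumr_const -cardsT -powersetT card_powerset cardsT card_ord.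
    by rewrite -natrX mulr_natl.
  rewrite [X in _ <= X + _]big_mkcond -big_split big_mkcond /=.
  apply: ler_sum => A _; case: ifP => [/andP[At /andP[A0 AB]]|_]; last first.
    by case: ifP => _; rewrite ?add0r ?addr_ge0 ?mulr_ge0 ?exprn_ge0 ?expR_ge0.
  rewrite -card_gt0 A0; set a := #|A|; set b := #|_ :\: _|.
  (* [tau] has only [d - 1] vertices, hence the [+ 1]. *)
  have sum_ab : a%:R + b%:R + d%:R = n%:R + 1 :> R.
    rewrite -!natrD natr1; congr _%:R.
    rewrite -[d in (_ + d)%N](prednK d0) -dt addnS; congr S.
    have tauC : (#|tau| + #|~: tau| = n)%N by rewrite cardsC card_ord.
    apply: etrans tauC.
    rewrite /a /b cardsD (finset.setIidPr At) subnKC ?subset_leq_card //.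
    by rewrite addnC.
  have [| | |le|le] := @link_exponent eps theta L d%:R n%:R a%:R b%:R
      (q * (p * (a * b)%:R)) eps0 dR1 _ _ sum_ab L0 th nb Lb _.
  - by rewrite ler1n.
  - by rewrite ler_nat.
  - rewrite natrM; have -> : n%:R * (q * (p * (a%:R * b%:R))) =
      q * (1 + eps) * (d%:R * L * (a%:R * b%:R)).
      by transitivity (q * (n%:R * p) * (a%:R * b%:R)); [ring|rewrite np; ring].
    rewrite -!(mulrA (1 + eps / 2)); apply: ler_wpM2r qe.
    by rewrite !mulr_ge0 // ltW.
  - apply: le_trans (_ : E1 * y ^+ a <= _); last by rewrite lerDl expR_ge0.
    by rewrite -expRM_natr -expRD ler_expR; lra.
  - apply: le_trans (_ : E2 <= _).
      by rewrite ler_expR lerN2.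
    by rewrite lerDr mulr_ge0 ?exprn_ge0 ?expR_ge0.
apply: le_trans (_ : expR ((d%:R - 1) * L) *
    (E1 * ((1 + y) ^+ n - 1) + 2 ^+ n * E2) <= _).
  apply: le_trans (_ : #|[set tau : {set 'I_n} | #|tau| == d.-1]|%:R *
      (E1 * ((1 + y) ^+ n - 1) + 2 ^+ n * E2) <= _).
    rewrite mulr_natl -sumr_const.
    under [leRHS]eq_bigl do rewrite inE.
    by apply: ler_sum => tau /eqP; apply: inner.
  apply: ler_wpM2r.
    rewrite addr_ge0 ?mulr_ge0 ?exprn_ge0 ?expR_ge0 // subr_ge0.
    by rewrite exprn_ege1 // lerDl.
  rewrite card_draws card_ord.
  have -> : expR ((d%:R - 1) * L) = (n ^ d.-1)%:R.
    rewrite -[in LHS](prednK d0) -natr1 addrK mulrC expRM_natr.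
    by rewrite natrX nE.
  by rewrite ler_nat bin_le_expn.
rewrite mulrDr; apply: lerD.
  rewrite mulrA -expRD subrr expR0 mul1r lerD2r.
  (* [(1 + y) ^+ n] is at most [expR (n * y)], and [n * y = expR (- (eps / 4 * d * L))]. *)
  apply: le_trans (_ : expR y ^+ n <= _).
    by rewrite lerXn2r ?nnegrE ?expR_ge0 ?addr_ge0 // expR_ge1Dx.
  rewrite -expRM_natr ler_expR nE -expRD ler_expR; lra.
(* With [2 <= expR 1] and [L <= n], the exponent is at most [(d - 1) * n + n - (d + 2) * n = - 2 * n
   <= - L]. *)
apply: le_trans (_ : expR ((d%:R - 1) * L) * (expR 1 ^+ n * E2) <= _).
  rewrite ler_pM2l ?expR_gt0 // ler_pM2r ?expR_gt0 //.
  rewrite lerXn2r ?nnegrE ?expR_ge0 //.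
  by have := expR_ge1Dx (1 : R); lra.
rewrite -expRM_natr -!expRD ler_expR.
have : (d%:R - 1) * L <= (d%:R - 1) * n%:R by rewrite ler_wpM2l //; lra.
lra.
Qed.

Lemma degree_union_bound n (p : R) : let L := ln (n%:R : R) in
  (0 < n)%N -> 0 <= L -> n%:R * p = (1 + eps) * d%:R * L ->
  #|ridges n d|%:R * expR (- (2 * (n%:R * p))) <= expR (- (d%:R * L)).
Proof.
have e0 := eps0; move=> L n0 L0 ->.
apply: le_trans (_ : expR (d%:R * L) *
    expR (- (2 * ((1 + eps) * d%:R * L))) <= _).
  rewrite ler_pM2r ?expR_gt0 // mulrC expRM_natr lnK ?posrE ?ltr0n //.
  by rewrite -natrX ler_nat /ridges card_draws card_ord bin_le_expn.
rewrite -expRD ler_expR.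
have : 0 <= eps * d%:R * L by rewrite !mulr_ge0 // ltW.
lra.
Qed.

End Estimates.

(** * Limits, choice of constants and conclusion *)

Local Open Scope classical_set_scope.
Local Open Scope ring_scope.

(** Each factor [n - i] of the falling factorial, with [i < m], is at least [n / 2]. *)
Lemma expn_le_bin n m : (2 * m <= n)%N -> (n ^ m <= 'C(n, m) * m`! * 2 ^ m)%N.
Proof.
move=> mn; rewrite bin_ffact ffact_prod.
rewrite -[X in (n ^ X)%N]card_ord -[X in (2 ^ X)%N]card_ord -!prod_nat_const.
rewrite -big_split /=; apply: leq_prod => i _.
by have := ltn_ord i; lia.
Qed.

Lemma ln_natr_cvgy (R : realType) : (ln (n%:R : R)) @[n --> \oo] --> +oo.
Proof.
apply/cvgryPge => A; near=> n.
have An : expR A <= n%:R by near: n; apply: nbhs_infty_ger.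
by rewrite -ler_expR lnK // posrE (lt_le_trans (expR_gt0 A)).
Unshelve. all: by end_near.
Qed.

Lemma expRN_ln_natr_cvg0 (R : realType) (k : R) : 0 < k ->
  (expR (- (k * ln (n%:R : R)))) @[n --> \oo] --> 0.
Proof.
move=> k0; have := @cvgr_expR R.
move=> /cvg_pinftyP/(_ (fun n => k * ln n%:R)); apply.
apply/cvgryPge => A.
have /cvgryPge/(_ (A / k)) := @ln_natr_cvgy R.
by apply: filterS => n; rewrite ler_pdivrMr // mulrC.
Qed.

Lemma half_lt_rate (R : realType) (eps : R) : 0 < eps ->
  exists t c : R, [/\ 0 <= t, 0 < c &
    1 + eps / 2 <= (1 - expR (- t) - c * t) * (1 + eps)].
Proof.
(* [eta] solves [(1 - eta) * (1 + eps) = 1 + eps / 2]; the witnesses make [expR (- t)] and [c * t]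
   each at most [eta / 2]. *)
move=> eps0; pose eta := eps / 2 / (1 + eps).
have etaE : eta * (1 + eps) = eps / 2 by rewrite /eta; field; lra.
have eta0 : 0 < eta by nra.
clearbody eta.
exists (2 / eta), (eta * eta / 4); split.
- by rewrite divr_ge0 // ltW.
- by rewrite !(mulr_gt0, invr_gt0).
have ct : eta * eta / 4 * (2 / eta) = eta / 2 by field; lra.
have et : expR (- (2 / eta)) <= eta / 2.
  rewrite expRN -[leRHS]invrK lef_pV2 ?posrE ?expR_gt0 ?invr_gt0 ?divr_gt0 //.
  rewrite invf_div; apply: le_trans (expR_ge1Dx _); lra.
rewrite ct; nra.
Qed.

(** ['C(n, d) * (n - d)] has order [n ^ d.+1], so all powers of [n] and [p] cancel and a constant
    remains. *)
Lemma bound_simplify (R : realType) (d n : nat) (c p e : R) : (0 < d)%N ->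
  (2 * d <= n)%N -> 0 < c -> 0 < p -> 0 < e ->
  c ^+ 2 / (e ^+ 2 * (16 ^ d * d * d`! * 2 ^ d.+1)%:R) <=
  c * p * (c * p * 'C(n, d)%:R * (n - d)%:R) /
    ((16 ^ d * n ^ d.-1)%:R * d%:R * (e * (n%:R * p)) ^+ 2).
Proof.
move=> d0 dn c0 p0 e0; have n0 : (0 < n)%N by lia.
have nR0 : 0 < n%:R :> R by rewrite ltr0n.
have h : (n ^ d.+1)%:R <= ('C(n, d) * d`! * 2 ^ d * (2 * (n - d)))%:R :> R.
  rewrite ler_nat expnSr leq_mul ?expn_le_bin //; lia.
rewrite ler_pdivrMr; last first.
  by rewrite mulr_gt0 ?exprn_gt0 // ltr0n !muln_gt0 !expn_gt0 d0 fact_gt0.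
rewrite mulrAC ler_pdivlMr; last first.
  by rewrite !mulr_gt0 ?exprn_gt0 ?mulr_gt0 ?ltr0n ?muln_gt0 ?expn_gt0 ?n0 ?d0.
have -> : c ^+ 2 * ((16 ^ d * n ^ d.-1)%:R * d%:R * (e * (n%:R * p)) ^+ 2) =
  (c * p * e) ^+ 2 * (16 ^ d * d)%:R * (n ^ d.+1)%:R.
  have -> : (n ^ d.+1 = n ^ d.-1 * (n * n))%N.
    by rewrite -[in LHS](prednK d0) !expnSr mulnA.
  by rewrite !natrM; ring.
have -> : c * p * (c * p * 'C(n, d)%:R * (n - d)%:R) *
    (e ^+ 2 * (16 ^ d * d * d`! * 2 ^ d.+1)%:R) =
  (c * p * e) ^+ 2 * (16 ^ d * d)%:R *
    ('C(n, d) * d`! * 2 ^ d * (2 * (n - d)))%:R.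
  by rewrite expnSr !natrM; ring.
by rewrite ler_wpM2l // mulr_ge0 ?sqr_ge0.
Qed.

Theorem theorem1p3 (R : realType) (d : nat) (hd : (0 < d)%N)
    (eps : R) (heps : 0 < eps) (p : nat -> R)
    (hp01 : forall n : nat, 0 <= p n <= 1)
    (hp : \forall n \near \oo,
      n%:R * p n = (1 + eps) * d%:R * ln (n%:R : R)) :
  exists delta : R, 0 < delta /\
    (fun n : nat => prob_Y (p n) d
       (fun Y : {set {set 'I_n}} => delta < conductance R d Y)) @ \oo --> (1 : R).
Proof.
have [t [c [t0 c0 rate]]] := half_lt_rate heps.
pose e : R := expR 1 + 1; have e0 : 0 < e by rewrite addr_gt0 ?expR_gt0.
(* Half of the constant in [bound_simplify], so that the final inequality is strict. *)
pose delta := c ^+ 2 / (e ^+ 2 * (16 ^ d * d * d`! * 2 ^ d.+1)%:R) / 2.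
have delta0 : 0 < delta.
  rewrite !divr_gt0 ?exprn_gt0 ?mulr_gt0 ?exprn_gt0 // ltr0n.
  by rewrite !muln_gt0 !expn_gt0 hd fact_gt0.
exists delta; split => //.
pose L n := ln (n%:R : R).
(* Failure bounds for large degrees, unbalanced link cuts and balanced link cuts, in this order. *)
pose err n := expR (- (d%:R * L n)) +
  ((expR (expR (- (eps / 4 * d%:R * L n))) - 1) + expR (- (1 * L n))).
(* This choice gives [(1 - theta) * (1 + eps / 2) = 1 + eps / 4]: a cut whose larger side has at
   least [(1 - theta) * n] vertices keeps a margin [eps / 4]. *)
pose theta := eps / 4 / (1 + eps / 2).
have thetaE : theta * (1 + eps / 2) = eps / 4 by rewrite /theta; field; lra.
have theta0 : 0 < theta by nra.
have dR0 : 0 < d%:R :> R by rewrite ltr0n.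
apply: (@squeeze_cvgr _ _ _ _ (fun n => 1 - err n) (fun=> 1));
  last exact: cvg_cst; last first.
  rewrite -[X in _ --> X]subr0; apply: cvgB; first exact: cvg_cst.
  rewrite -[X in _ --> X]addr0; apply: cvgD; first exact: expRN_ln_natr_cvg0.
  rewrite -[X in _ --> X]addr0; apply: cvgD; last exact: expRN_ln_natr_cvg0.
  rewrite -[X in _ --> X](subrr 1); apply: cvgB; last exact: cvg_cst.
  rewrite -[X in _ --> X]expR0; apply: continuous_cvg.
    exact: continuous_expR.
  by apply: expRN_ln_natr_cvg0; rewrite !mulr_gt0.
have Ly := @ln_natr_cvgy R.
near=> n.
have np : n%:R * p n = (1 + eps) * d%:R * L n by near: n.
have L0 : 0 < L n by near: n; have /cvgryPgt/(_ 0) := Ly.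
have Lb : 8 * (d%:R + 2) <= theta * L n.
  rewrite [leRHS]mulrC -ler_pdivrMr //; near: n.
  by have /cvgryPge/(_ (8 * (d%:R + 2) / theta)) := Ly.
have nb : 2 * d%:R <= theta * n%:R.
  by rewrite [leRHS]mulrC -ler_pdivrMr //; near: n; apply: nbhs_infty_ger.
have dn : (2 * d < n)%N by near: n; apply: nbhs_infty_gt.
have n0 : (0 < n)%N := leq_ltn_trans (leq0n _) dn.
have p0 : 0 < p n.
  have nR0 : 0 < n%:R :> R by rewrite ltr0n.
  by rewrite -(pmulr_rgt0 _ nR0) np !mulr_gt0 // addr_gt0.
set E := (X in prob_Y _ _ X).
have -> : prob_Y (p n) d E =
    1 - prob_faces d (p n) (fun F => ~~ E (full_complex d F)).
  by rewrite prob_facesC ?hp01 // subKr.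
apply/andP; split; last first.
  rewrite gerBl; apply: sumr_ge0 => F _; exact: weight_ge0.
rewrite lerB //.
have bad := @prob_bad_complex R n d (p n) (hp01 n) hd t c t0.
apply: (le_trans (le_trans _ bad)).
  (* The union bound over [unit] serves as monotonicity: small conductance forces a bad complex. *)
  apply: le_trans (union_bound (hp01 n) (D := predT) (c := fun (_ : unit) F =>
    ~~ (link_expanding d (c * p n) F && [forall s in ridges n d,
      (deg d (full_complex d F) s)%:R <= e * (n%:R * p n)])) _) _; last first.
    by rewrite big_const card_unit /= addr0.
  move=> F FC; rewrite /E => small; exists tt => //.
  apply: contra small => /andP[EF /forall_inP DF].
  apply: lt_le_trans (_ : 2 * delta <= _); first by rewrite ltr_pMl // ltr1n.
  apply: (conductance_lower_bound hd FC _ _ EF DF); rewrite ?mulr_gt0 //.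
    exact: leq_ltn_trans (leq_pmull _ _) dn.
  by rewrite /delta mulrC divfK //; apply: bound_simplify => //; apply: ltnW.
apply: lerD.
  exact: (degree_union_bound heps n0 (ltW L0) np).
rewrite mul1r.
exact: (@link_union_bound R d eps hd heps n _ (p n) theta).
Unshelve. all: by end_near.
Qed.
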